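(* Let $n\ge 2$ and $r\ge 2$ be integers and let $A$ be a nonnegative $r$-potent $n\times n$ real matrix. (1) If $\operatorname{rank}(A)>r-1$, then $A$ is decomposable. (2) If $r\ge 3$, $\operatorname{rank}(A)\le r-1$, $A$ is singular, and each of the matrices $A^2,A^3,\dots,A^{r-1}$ has at least one diagonal entry equal to zero, then $A$ is decomposable.
   Context: A real matrix $A=(a_{ij})$ is nonnegative if $a_{ij}\ge 0$ for all $i,j$. A square matrix $A$ is $r$-potent if $A^r=A$. An $n\times n$ real matrix $A$ is decomposable if there is a nonempty proper subset $\{i_1,\dots,i_k\}$ of $\{1,\dots,n\}$ such that the linear span of $Ae_{i_1},\dots,Ae_{i_k}$ is contained in the linear span of $e_{i_1},\dots,e_{i_k}$, where $e_1,\dots,e_n$ is the standard basis of $\mathbb{R}^n$. Equivalently, there is a permutation matrix $P$ such that $P^{-1}AP=\begin{pmatrix} B & C\\ 0 & D\end{pmatrix}$ with $B$ and $D$ square (of positive size). *)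

(* Defs.v *)
From HB Require Import structures.
From mathcomp Require Import all_boot all_order all_algebra.
From mathcomp Require Import all_reals.

Set Implicit Arguments.
Unset Strict Implicit.
Unset Printing Implicit Defensive.

Import Order.TTheory GRing.Theory Num.Theory.
Local Open Scope ring_scope.

Definition nonnegative_mx (R : realType) (n : nat) (A : 'M[R]_n) : Prop :=
  forall i j : 'I_n, 0 <= A i j.

Definition potent_mx (R : realType) (n r : nat) (A : 'M[R]_n) : Prop :=
  A ^+ r = A.

Definition std_basis (R : realType) (n : nat) (i : 'I_n) : 'cV[R]_n :=
  delta_mx i 0.

Definition decomposable_mx (R : realType) (n : nat) (A : 'M[R]_n) : Prop :=
  exists S : {set 'I_n},
    [/\ S != set0,
        S \proper [set: 'I_n]
      & (<<[seq A *m std_basis R i | i in S]>>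
           <= <<[seq std_basis R i | i in S]>>)%VS].

(* Main.v *)
(** Let T = A + A^2 + ... + A^(r-1).  Since A T = T, the support of each column
    of T is invariant under A; so if A is indecomposable then every entry of T
    is positive.  Moreover T^2 = (r-1) T, hence T / (r-1) is a positive
    idempotent, which has rank at most 1, so tr T <= r-1.  The idempotent
    E = A^(r-1) has the same rank as A, and rank E = tr E <= tr T <= r-1, which
    gives (1).  For (2), T i i > 0 gives (A^m) i i > 0 for some 0 < m < r, hence
    E i i >= ((A^m) i i)^(r-1) > 0 for every i, against the case k = r-1 of the
    hypothesis. *)
Require Import Defs.
From HB Require Import structures.
From mathcomp Require Import all_boot all_order all_algebra.
From mathcomp Require Import all_reals.

Set Implicit Arguments.
Unset Strict Implicit.
Unset Printing Implicit Defensive.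

Import Order.TTheory GRing.Theory Num.Theory.
Local Open Scope ring_scope.

(** Column [j] of [A] with [j] in [S] is supported in [S], so [A *m std_basis R j] is a combination
    of the basis vectors indexed by [S]. *)
Lemma decomposable_invariant (R : realType) (n : nat) (A : 'M[R]_n)
    (S : {set 'I_n}) :
  S != set0 -> S != setT ->
  (forall i j, j \in S -> i \notin S -> A i j = 0) -> decomposable_mx A.
Proof.
move=> S0 ST Sinv; exists S; split=> //; first by rewrite properT.
apply/span_subvP => _ /imageP[j jS ->].
have -> : A *m std_basis R j = \sum_(i in S) A i j *: std_basis R i.
  apply/colP => k; rewrite -colE mxE summxE.
  under eq_bigr do rewrite !mxE eqxx andbT.
  have [kS|kS] := boolP (k \in S).
    rewrite (bigD1 k) //= eqxx mulr1 big1 ?addr0 // => i /andP[_ ik].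
    by rewrite eq_sym (negPf ik) mulr0.
  rewrite (Sinv k j) // big1 // => i iS.
  by case: eqP kS => [->|_ _]; rewrite ?iS ?mulr0.
apply: memv_suml => i iS; apply/memvZ/memv_span.
by apply: image_f.
Qed.

Section NonnegativeMatrices.
Variables (R : realType) (n : nat).
Implicit Types A B P : 'M[R]_n.

Lemma nonnegative_mul A B :
  nonnegative_mx A -> nonnegative_mx B -> nonnegative_mx (A * B).
Proof. by move=> hA hB i j; rewrite mxE sumr_ge0 // => k _; rewrite mulr_ge0. Qed.

Lemma nonnegative_exp A k : nonnegative_mx A -> nonnegative_mx (A ^+ k).
Proof.
move=> hA; elim: k => [|k IH]; last by rewrite exprS; apply: nonnegative_mul.
by move=> i j; rewrite expr0 mxE ler0n.
Qed.

Lemma le_entry_mul A B i j k :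
  nonnegative_mx A -> nonnegative_mx B -> A i k * B k j <= (A * B) i j.
Proof.
move=> hA hB; rewrite mxE (bigD1 k) //= lerDl sumr_ge0 // => l _.
by rewrite mulr_ge0.
Qed.

Lemma exp_diag_le A i k : nonnegative_mx A -> A i i ^+ k <= (A ^+ k) i i.
Proof.
move=> hA; elim: k => [|k IH]; first by rewrite !expr0 mxE eqxx.
rewrite !exprS; apply: le_trans (le_entry_mul i i i hA (nonnegative_exp k hA)).
by rewrite ler_wpM2l.
Qed.

(** In a full-rank factorization [P = C *m D], cancelling the outer [C] and [D] from [C D C D = C D]
    leaves [D C = 1], an identity of size [\rank P]. *)
Lemma rank_idempotent P : P * P = P -> (\rank P)%:R = \tr P.
Proof.
move=> PP; pose C := col_base P; pose D := row_base P.
have CD : C *m D = P := mulmx_base P.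
have DC : D *m C = 1%:M.
  apply: (row_full_inj (col_base_full P)); apply: (row_free_inj (row_base_free P)).
  by rewrite mulmx1 -/C -/D mulmxA -mulmxA CD; apply: PP.
by rewrite -CD mxtrace_mulC DC mxtrace1 CD.
Qed.

(* Two columns of P are positive fixed vectors v, w of P.  With t the least
   ratio v_i / w_i, the fixed vector v - t w is nonnegative with a zero entry,
   so it vanishes because P maps nonzero nonnegative vectors to positive ones. *)
Lemma rank_positive_idempotent P :
  (forall i j, 0 < P i j) -> P * P = P -> (\rank P <= 1)%N.
Proof.
move=> Ppos PP.
case: (pickP 'I_n) => [c _|n0]; last first.
  rewrite (_ : P = 0) ?mxrank0 //; apply/matrixP => i.
  by have := n0 i.
have prop j : exists t, forall i, P i j = P i c * t.
  pose k := [arg min_(i < c) (P i j / P i c)]%O.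
  have kmin i : P k j / P k c <= P i j / P i c.
    by rewrite /k; case: arg_minP => // k' _ ->.
  pose t := P k j / P k c; exists t.
  pose u i := P i j - P i c * t.
  have u_ge0 i : 0 <= u i by rewrite subr_ge0 mulrC -ler_pdivlMr ?kmin.
  have ufix i : u i = \sum_l P i l * u l.
    rewrite /u -{1 2}PP !mxE mulr_suml -sumrB.
    by apply: eq_bigr => l _; rewrite mulrBr (mulrA _ _ t).
  have uk : u k = 0 by rewrite /u mulrC divfK ?subrr // gt_eqF.
  move=> i; apply/eqP; rewrite -subr_eq0 -/(u i).
  have /eqP := ufix k; rewrite uk eq_sym psumr_eq0; last first.
    by move=> l _; rewrite mulr_ge0 // ltW.
  move=> /allP/(_ i (mem_index_enum _)) /=.
  by rewrite mulf_eq0 (gt_eqF (Ppos k i)).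
have Pc0 : P c c != 0 by rewrite gt_eqF.
(* The ratio [t] of column [j] to column [c] is read off in row [c]; [P] is then a column times a
   row. *)
have -> : P = col c P *m (\row_j (P c j / P c c)).
  apply/matrixP => i j; have [t tP] := prop j.
  by rewrite mxE big_ord1 !mxE (tP i) (tP c) (mulrC (P c c)) mulfK.
by rewrite (leq_trans (mxrankM_maxl _ _)) ?rank_leq_col.
Qed.

End NonnegativeMatrices.

Section PotentMatrices.
Variables (R : realType) (n q : nat) (A : 'M[R]_n).
Hypotheses (hA : nonnegative_mx A) (hAr : potent_mx q.+2 A).

Definition power_sum : 'M[R]_n := \sum_(m < q.+1) A ^+ m.+1.
Local Notation T := power_sum.

(** Multiplication by [A] permutes the summands cyclically: the last becomes [A ^+ q.+2 = A]. *)
Lemma mul_power_sum : A * T = T.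
Proof.
rewrite /T mulr_sumr big_ord_recr [RHS]big_ord_recl /= -exprS hAr expr1 addrC.
by congr (_ + _); apply: eq_bigr => m _; rewrite -exprS.
Qed.

Lemma power_sum_sqr : T * T = T *+ q.+1.
Proof.
have AT m : A ^+ m * T = T.
  by elim: m => [|m IH]; rewrite ?expr0 ?mul1r // exprSr -mulrA mul_power_sum.
by rewrite {1}/T mulr_suml; under eq_bigr do rewrite AT; rewrite sumr_const card_ord.
Qed.

Lemma power_sum_nonneg : nonnegative_mx T.
Proof. by move=> i j; rewrite summxE sumr_ge0 // => m _; apply: nonnegative_exp. Qed.

Lemma le_power_sum (m : 'I_q.+1) i j : (A ^+ m.+1) i j <= T i j.
Proof.
rewrite summxE (bigD1 m) //= lerDl sumr_ge0 // => l _.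
exact: nonnegative_exp.
Qed.

Lemma potent_exp_idempotent : A ^+ q.+1 * A ^+ q.+1 = A ^+ q.+1.
Proof. by rewrite {1}exprSr -mulrA -exprS hAr -exprSr. Qed.

Lemma power_sum_pos_or_decomposable :
  (2 <= n)%N -> (forall i j, 0 < T i j) \/ decomposable_mx A.
Proof.
move=> hn; have [/forallP Tpos|] := boolP [forall i, forall j, 0 < T i j].
  by left=> i j; apply/forallP: j; apply: Tpos.
rewrite negb_forall => /existsP[i]; rewrite negb_forall => /existsP[j Tij].
right; pose S := [set k | 0 < T k j].
(* If column [j] of [T] is zero, so is column [j] of [A], as [A <= T] entrywise; then [[set j]] is
   invariant, and proper since [n >= 2]. *)
have [S0|S0] := eqVneq S set0.
  apply: (@decomposable_invariant _ _ _ [set j]).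
  - by apply/set0Pn; exists j; rewrite inE.
  - by apply: contraTneq hn => /(congr1 (fun X : {set _} => #|X|)); rewrite cards1 cardsT card_ord => <-.
  move=> k l /set1P-> _; apply/eqP; rewrite eq_le hA andbT.
  apply: le_trans (le_power_sum ord0 k j) _.
  by rewrite leNgt; apply/negP => Tkj; move: (in_set0 k); rewrite -S0 inE Tkj.
apply: (decomposable_invariant S0).
  by apply: contraNneq Tij => ST; move: (in_setT i); rewrite -ST inE.
(* Here [A k l * T l j <= (A * T) k j = T k j <= 0] with [T l j > 0]. *)
move=> k l; rewrite !inE -leNgt => Tlj Tkj; apply/eqP; rewrite eq_le hA andbT.
rewrite -(pmulr_lle0 _ Tlj); apply: le_trans Tkj.
rewrite -[in leRHS]mul_power_sum.
exact: le_entry_mul power_sum_nonneg.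
Qed.

Lemma rank_potent_le : (forall i j, 0 < T i j) -> (\rank A <= q.+1)%N.
Proof.
move=> Tpos; set E := A ^+ q.+1.
have q0 : 0 < q.+1%:R :> R by rewrite ltr0n.
pose P := q.+1%:R^-1 *: T.
have TP : T = q.+1%:R *: P by rewrite scalerA divff ?scale1r ?gt_eqF.
have PP : P * P = P.
  rewrite /P -!mulmxE -scalemxAl -scalemxAr mulmxE power_sum_sqr -scaler_nat.
  by rewrite (scalerA _ _ T) mulVf ?scale1r ?gt_eqF.
have trT : \tr T <= q.+1%:R.
  rewrite TP mxtraceZ -(rank_idempotent PP) ler_piMr ?ler0n // lern1.
  by apply: rank_positive_idempotent PP => i j; rewrite mxE mulr_gt0 ?invr_gt0.
(* [A = A * E] because [A ^+ q.+2 = A]. *)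
have rkA : (\rank A <= \rank E)%N.
  by rewrite -[in leqLHS]hAr exprS -mulmxE mxrankM_maxr.
apply: leq_trans rkA _; rewrite -(ler_nat R) (rank_idempotent potent_exp_idempotent).
apply: le_trans trT; apply: ler_sum => i _.
exact: (le_power_sum ord_max).
Qed.

Lemma potent_exp_diag_gt0 i : 0 < T i i -> 0 < (A ^+ q.+1) i i.
Proof.
rewrite summxE => Tii.
have /existsP[m Am] : [exists m : 'I_q.+1, 0 < (A ^+ m.+1) i i].
  apply: contraLR Tii; rewrite negb_exists -leNgt => /forallP Am.
  by apply: sumr_le0 => m _; rewrite leNgt.
(* Swapping the exponents gives a positive power of the idempotent [A ^+ q.+1]. *)
have EE : (A ^+ m.+1) ^+ q.+1 = A ^+ q.+1.
  rewrite exprAC; elim: (nat_of_ord m) => [|k IH]; first by rewrite expr1.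
  by rewrite exprS IH potent_exp_idempotent.
rewrite -EE; apply: lt_le_trans (exp_diag_le _ _ (nonnegative_exp _ hA)).
exact: exprn_gt0.
Qed.

End PotentMatrices.

Theorem theorem3p2 (R : realType) (n r : nat) (A : 'M[R]_n)
    (hn : (2 <= n)%N) (hr : (2 <= r)%N)
    (hA : nonnegative_mx A) (hAr : potent_mx r A) :
  ((r - 1 < \rank A)%N -> decomposable_mx A) /\
  ((3 <= r)%N ->
   (\rank A <= r - 1)%N ->
   A \notin unitmx ->
   (forall k : nat, (2 <= k <= r - 1)%N ->
      exists i : 'I_n, (A ^+ k) i i = 0) ->
   decomposable_mx A).
Proof.
case: r hr hAr => [|[|q]] // _ hAq; rewrite subn1 /=.
have [Tpos|dec] := power_sum_pos_or_decomposable hA hAq hn; last by split.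
split=> [|q3 _ _ /(_ q.+1)]; first by rewrite ltnNge rank_potent_le.
(* The bound [3 <= r] makes the exponent [q.+1 = r - 1] at least 2. *)
rewrite -ltnS q3 leqnn => /(_ isT)[i Eii].
by have := potent_exp_diag_gt0 hA hAq (Tpos i i); rewrite Eii ltxx.
Qed.
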